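(* Let $\alpha\in\ell^2$. For every $p\in(1,\infty)$ there exists a constant $C_p>0$ depending only on $p$ such that $$\|(a_k(R_\alpha))_{k\ge1}\|_{\ell^p}\le C_p\Big(\sum_{k\ge-1}|\sigma_k|^p\Big)^{1/p}.$$
   Context: $\mathbb{N}=\{0,1,2,\dots\}$; $(R_\alpha f)(k)=\alpha_k\sum_{j=0}^kf(j)$ on $\ell^2$ (square-summable functions $\mathbb{N}\to\mathbb{C}$). $\sigma_{-1}=|\alpha_0|$ and $\sigma_k=(\sum_{j=2^k}^{2^{k+1}-1}(j+1)|\alpha_j|^2)^{1/2}$ for $k\in\mathbb{N}$. Approximation numbers: $a_{n+1}(T)=\inf\{\|T-P\|:P$ linear with rank $\le n\}$, $n\ge0$. *)

(* Defs.v *)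
From HB Require Import structures.
From mathcomp Require Import all_boot all_order all_algebra.
From mathcomp Require Import complex.
From mathcomp Require Import all_classical all_reals all_analysis.
Set Implicit Arguments. Unset Strict Implicit. Unset Printing Implicit Defensive.
Import Order.TTheory GRing.Theory Num.Theory.
Local Open Scope classical_set_scope.
Local Open Scope ring_scope.

Section Defs.
Variable R : realType.
Local Notation C := R[i].

Definition cmod (z : C) : R := ComplexField.Normc.normc z.

Definition l2norm2 (f : nat -> C) : \bar R :=
  (\sum_(0 <= k <oo) ((cmod (f k)) ^+ 2)%:E)%E.
Definition inl2 (f : nat -> C) : Prop := (l2norm2 f < +oo)%E.
Definition l2norm (f : nat -> C) : \bar R := ((l2norm2 f) `^ (2^-1))%E.

(* operator norm on l^2 (in \bar R; +oo if unbounded or not l^2-valued) *)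
Definition opnorm (S : (nat -> C) -> (nat -> C)) : \bar R :=
  ereal_sup [set l2norm (S f) | f in [set f | inl2 f /\ (l2norm f <= 1)%E]].

Definition Ralpha (alpha : nat -> C) (f : nat -> C) : nat -> C :=
  fun k => alpha k * \sum_(j < k.+1) f j.

Definition lin_rank_le (n : nat) (P : (nat -> C) -> (nat -> C)) : Prop :=
  (forall (a : C) f g, inl2 f -> inl2 g ->
     P (fun k => a * f k + g k) = (fun k => a * P f k + P g k)) /\
  exists g : 'I_n -> (nat -> C), (forall i, inl2 (g i)) /\
    forall f, inl2 f -> exists c : 'I_n -> C,
      P f = (fun k => \sum_(i < n) c i * g i k).

(* approx_num T n = a_{n+1}(T) = inf { ||T - P|| : P linear, rank <= n } *)
Definition approx_num (T : (nat -> C) -> (nat -> C)) (n : nat) : \bar R :=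
  ereal_inf [set opnorm (fun f k => T f k - P f k) | P in lin_rank_le n].

(* sigma_seq k = sigma_{k-1} of the paper: sigma_seq 0 = |alpha_0|,
   sigma_seq (k+1) = (sum_{j=2^k}^{2^{k+1}-1} (j+1)|alpha_j|^2)^{1/2} *)
Definition sigma_seq (alpha : nat -> C) (k : nat) : R :=
  match k with
  | 0 => cmod (alpha 0%N)
  | k'.+1 => Num.sqrt (\sum_(2 ^ k' <= j < 2 ^ k'.+1) (j.+1)%:R * (cmod (alpha j)) ^+ 2)
  end.

End Defs.

(* Main.v *)
Require Import Defs.
From HB Require Import structures.
From mathcomp Require Import all_boot all_order all_algebra.
From mathcomp Require Import complex.
From mathcomp Require Import all_classical all_reals all_analysis.
From mathcomp Require Import zify ring lra.
Set Implicit Arguments. Unset Strict Implicit. Unset Printing Implicit Defensive.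
Import Order.TTheory GRing.Theory Num.Theory.
Local Open Scope classical_set_scope.
Local Open Scope ring_scope.

(** Write [s_b] for the [b]-th entry of the sequence [sigma] and fix a level [t > 0].
    On the dyadic blocks with [s_b > t] the index set is cut into about [s_b / t]
    intervals, on each of which both the length and the mass of [alpha] are so small
    that the partial sums of [f] taken from the start of the interval only contribute
    an operator of norm at most [t]; what is left on such an interval is a rank-one
    operator.  On the blocks with [s_b <= t] nothing is removed: a Schur test with
    geometric block weights (a dyadic Hardy inequality) bounds these rows by a multiple
    of [t].  Hence at most [C * \sum_(s_b > t) s_b / t] approximation numbers exceed
    [4 t], and summing over the levels [t = M / 2 ^ m] gives the claim, the geometric
    series in [m] converging exactly because [p > 1]. *)

(** * Weighted Cauchy-Schwarz, Schur test, and sums over ranges of partial sums *)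

Section WeightedInequalities.
Variable R : realType.
Implicit Types (a u h w x : nat -> R) (k : rel nat).

Lemma ler_double_add_of_sqr_le_mul (P Q y : R) :
  0 <= P -> 0 <= Q -> y ^+ 2 <= P * Q -> 2 * y <= P + Q.
Proof.
move=> P0 Q0 yPQ; rewrite leNgt; apply/negP => lt.
have : (P + Q) ^+ 2 < (2 * y) ^+ 2 by rewrite ltr_pXn2r ?nnegrE //; lra.
have : 0 <= (P - Q) ^+ 2 by exact: sqr_ge0.
by nra.
Qed.

Lemma weighted_cauchy_schwarz (s : seq nat) (Q : pred nat) h x :
  (forall j, 0 < h j) ->
  (\sum_(j <- s | Q j) x j) ^+ 2 <=
  (\sum_(j <- s | Q j) (h j)^-1) * (\sum_(j <- s | Q j) h j * x j ^+ 2).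
Proof.
move=> h0; elim: s => [|j s IH]; first by rewrite !big_nil expr0n /= mulr0.
rewrite !big_cons; case: ifP => // _; move: IH.
set S := \sum_(j <- s | Q j) x j; set A := \sum_(j <- s | Q j) (h j)^-1.
set B := \sum_(j <- s | Q j) h j * x j ^+ 2 => IH.
have A0 : 0 <= A by apply: sumr_ge0 => i _; rewrite invr_ge0 ltW.
have B0 : 0 <= B by apply: sumr_ge0 => i _; rewrite mulr_ge0 ?sqr_ge0 ?ltW.
have hj := h0 j; have hVj : 0 < (h j)^-1 by rewrite invr_gt0.
have hK : (h j)^-1 * h j = 1 by rewrite mulVf ?gt_eqF.
(* The cross term of the new square: by the induction hypothesis the product of the two summands on
   the right is at least [(x j * S) ^+ 2], and the arithmetic-geometric mean inequality applies. *)
have : 2 * (x j * S) <= A * (h j * x j ^+ 2) + (h j)^-1 * B.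
  apply: ler_double_add_of_sqr_le_mul.
  - by rewrite mulr_ge0 // mulr_ge0 ?sqr_ge0 // ltW.
  - by rewrite mulr_ge0 // ltW.
  - rewrite exprMn.
    have -> : A * (h j * x j ^+ 2) * ((h j)^-1 * B) = x j ^+ 2 * (A * B).
      by transitivity (x j ^+ 2 * (A * B) * ((h j)^-1 * h j)); [ring|rewrite hK mulr1].
    by rewrite ler_wpM2l ?sqr_ge0.
move=> H; rewrite mulrDl !mulrDr [(h j)^-1 * (h j * _)]mulrA hK mul1r sqrrD.
by lra.
Qed.

(** Cauchy-Schwarz with weight [h] in each row, then an exchange of the two sums. The majorant [u]
    of the row sums lets the column condition be checked on something simpler than the row sums
    themselves. *)
Lemma schur_test n k a u h x (c : R) :
  (forall j, 0 < h j) -> (forall i, 0 <= a i) ->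
  (forall i, a i * (\sum_(0 <= j < n | k i j) (h j)^-1) <= u i) ->
  (forall j, h j * (\sum_(0 <= i < n | k i j) u i) <= c) ->
  \sum_(0 <= i < n) a i * (\sum_(0 <= j < n | k i j) x j) ^+ 2 <=
  c * \sum_(0 <= j < n) x j ^+ 2.
Proof.
move=> h0 a0 row col.
have step i : a i * (\sum_(0 <= j < n | k i j) x j) ^+ 2 <=
    \sum_(0 <= j < n | k i j) u i * (h j * x j ^+ 2).
  rewrite -mulr_sumr.
  apply: (@le_trans _ _ (a i * ((\sum_(0 <= j < n | k i j) (h j)^-1) *
      (\sum_(0 <= j < n | k i j) h j * x j ^+ 2)))).
    by rewrite ler_wpM2l // weighted_cauchy_schwarz.
  rewrite mulrA ler_wpM2r // sumr_ge0 // => j _.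
  by rewrite mulr_ge0 ?sqr_ge0 // ltW.
apply: (le_trans (ler_sum _ (fun i _ => step i))).
rewrite (exchange_big_dep predT) //= mulr_sumr; apply: ler_sum => j _.
rewrite -mulr_suml mulrA [X in X * _]mulrC ler_wpM2r ?sqr_ge0 //.
Qed.

Lemma big_nat_recr_cond n (Q : pred nat) x :
  \sum_(0 <= j < n.+1 | Q j) x j =
  \sum_(0 <= j < n | Q j) x j + (if Q n then x n else 0).
Proof. by rewrite big_mkcond big_nat_recr //= -big_mkcond. Qed.

Definition psum w n := \sum_(0 <= j < n) w j.

Lemma psumS w n : psum w n.+1 = psum w n + w n.
Proof. by rewrite /psum big_nat_recr. Qed.

Lemma psum_mono w : (forall j, 0 <= w j) ->
  {homo psum w : m n / (m <= n)%N >-> m <= n}.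
Proof.
move=> w0 m n le_mn; rewrite /psum [leRHS](big_cat_nat _ (n := m)) //= lerDl.
by apply: sumr_ge0.
Qed.

(** Partial sums increase, so the selected indices form a final segment; its weights telescope from
    a partial sum that is already at least [c]. *)
Lemma sum_psum_ge w (c : R) n : (forall j, 0 <= w j) ->
  \sum_(0 <= j < n | c <= psum w j) w j <= Num.max 0 (psum w n - c).
Proof.
move=> w0; elim: n => [|n IH]; first by rewrite big_nil le_max lexx.
rewrite big_nat_recr_cond psumS.
have wn := w0 n; move: (\sum_(0 <= j < n | c <= psum w j) w j) IH => S.
case: ifP => [|/negbT]; rewrite -?ltNge => cn; rewrite !le_max => /orP[] H; apply/orP.
- by right; lra.
- by right; lra.
- by left; lra.
- by left; lra.
Qed.

(** The selected indices form a segment starting at [m], and the partial sum just after its last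
    index is still at most [d]. *)
Lemma sum_psum_le w (d : R) m n : (forall j, 0 <= w j) ->
  \sum_(0 <= i < n | (m <= i)%N && (psum w i.+1 <= d)) w i
    <= Num.max 0 (d - psum w m).
Proof.
move=> w0; elim: n => [|n IH]; first by rewrite big_nil le_max lexx.
rewrite big_nat_recr_cond.
case: ifP => [/andP[mn nd]|_]; last by rewrite addr0.
have le : \sum_(0 <= i < n | (m <= i)%N && (psum w i.+1 <= d)) w i <= psum w n - psum w m.
  rewrite /psum [\sum_(0 <= j < n) _](big_cat_nat _ (n := m)) //= addrAC subrr add0r.
  rewrite (big_cat_nat _ (n := m)) //= big_nat_cond big1 ?add0r; last first.
    by move=> i; lia.
  by rewrite big_mkcond; apply: ler_sum => i _; case: ifP.
by rewrite le_max; move: nd; rewrite psumS => nd; apply/orP; right; lra.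
Qed.

End WeightedInequalities.

(** * Dyadic blocks of indices *)

Section DyadicBlocks.

(* Block 0 is {0} and block b + 1 is [2 ^ b, 2 ^ b.+1), matching [sigma_seq]. *)
Definition block_start (b : nat) : nat := (2 ^ b)./2.
Definition block_index (j : nat) : nat := up_log 2 j.+1.

Lemma block_startS b : block_start b.+1 = (2 ^ b)%N.
Proof. by rewrite /block_start expnS mul2n doubleK. Qed.

Lemma block_start_lt b : (block_start b < 2 ^ b)%N.
Proof. by case: b => [//|b]; rewrite block_startS expnS; have := expn_gt0 2 b; lia. Qed.

Lemma block_indexP j : (block_start (block_index j) <= j < 2 ^ block_index j)%N.
Proof.
rewrite up_logP // andbT; case: j => [|j]; first by rewrite /block_index up_log1.
have lt1 : (1 < j.+2)%N by [].
have := up_log_gtn (isT : (1 < 2)%N) lt1.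
rewrite /block_index; case: (up_log 2 j.+2) => [//|m].
by rewrite block_startS.
Qed.

Lemma block_index_eq b j : (block_start b <= j < 2 ^ b)%N -> block_index j = b.
Proof.
case: b => [|b]; last by rewrite block_startS => ?; apply: up_log_eq; lia.
by case: j.
Qed.

Lemma block_index_mono : {homo block_index : i j / (i <= j)%N}.
Proof. by move=> i j ij; apply: leq_up_log. Qed.

Lemma block_size_le j :
  (2 ^ block_index j - block_start (block_index j) <= j.+1)%N.
Proof.
have := block_indexP j; case: (block_index j) => [//|b].
by rewrite block_startS expnS; lia.
Qed.

Lemma sum_dyadic (V : nmodType) (F : nat -> V) N :
  \sum_(0 <= j < 2 ^ N) F j =
  \sum_(0 <= b < N.+1) \sum_(block_start b <= j < 2 ^ b) F j.
Proof.
elim: N => [|N IH]; first by rewrite !big_nat1.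
rewrite [RHS]big_nat_recr //= -IH block_startS (big_cat_nat _ (n := (2 ^ N)%N)) //=.
by rewrite leq_exp2l.
Qed.

End DyadicBlocks.

(** * Geometric tails and the masses [sigma_seq] of the blocks *)

Section Estimates.
Variable R : realType.

Lemma ler_sum_nat_widen n m (Q Q' : pred nat) (F : nat -> R) :
  (forall j, 0 <= F j) ->
  (forall j, (j < n)%N -> Q j -> (j < m)%N && Q' j) ->
  \sum_(0 <= j < n | Q j) F j <= \sum_(0 <= j < m | Q' j) F j.
Proof.
move=> F0 QQ'.
rewrite (big_nat_widen _ _ _ _ _ (leq_maxl n m)) (big_nat_widen 0 m _ _ _ (leq_maxr n m)).
rewrite big_mkcond [leRHS]big_mkcond; apply: ler_sum => j _.
case: ifP => [/andP[Qj jn]|_]; last by case: ifP.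
by have /andP[-> ->] := QQ' j jn Qj.
Qed.

(** An exact identity with its remainder term, in a form that passes through induction on [m]
    without division. *)
Lemma geometric_tail (q : R) B m :
  (\sum_(0 <= b < m | (B <= b)%N) q ^+ b) * (1 - q) + q ^+ maxn B m = q ^+ B.
Proof.
elim: m => [|m IH]; first by rewrite big_nil mul0r add0r maxn0.
rewrite big_nat_recr_cond; case: (leqP B m) => Bm; last first.
  rewrite addr0 (maxn_idPl _) //; move: IH; rewrite (maxn_idPl _) //; exact: ltnW.
rewrite (maxn_idPr _); last exact: leqW.
by rewrite -IH (maxn_idPr Bm) exprS; ring.
Qed.

Lemma geometric_tail_le (q : R) B m : 0 <= q < 1 ->
  \sum_(0 <= b < m | (B <= b)%N) q ^+ b <= q ^+ B / (1 - q).
Proof.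
move=> /andP[q0 q1]; rewrite ler_pdivlMr ?subr_gt0 // -[leRHS](geometric_tail _ B m).
by rewrite lerDl exprn_ge0.
Qed.

Variable alpha : nat -> R[i].

Local Notation sig := (sigma_seq alpha).
Local Notation beta j := (j.+1%:R * cmod (alpha j) ^+ 2).

Lemma cmod_ge0 (z : R[i]) : 0 <= cmod z.
Proof. by rewrite /cmod; case: z => x y; exact: sqrtr_ge0. Qed.

Lemma sigma_ge0 b : 0 <= sig b.
Proof. by case: b => [|b]; [exact: cmod_ge0|exact: sqrtr_ge0]. Qed.

Lemma weighted_cmod_ge0 j : 0 <= beta j.
Proof. by rewrite mulr_ge0 ?sqr_ge0. Qed.

Lemma sigma_sqr b :
  sig b ^+ 2 = \sum_(block_start b <= j < 2 ^ b) beta j.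
Proof.
case: b => [|b]; first by rewrite big_nat1 mul1r.
rewrite block_startS sqr_sqrtr //; apply: sumr_ge0 => j _.
exact: weighted_cmod_ge0.
Qed.

(** * Cutting the large blocks at level [t], and the rows inside one interval *)

Variable t : R.
Hypothesis t0 : 0 < t.

Definition block_size b : nat := (2 ^ b - block_start b)%N.

(* The intervals are the level sets of the integer part of the partial sums of this
   weight.  Its three terms control, in this order, the mass of alpha on an interval,
   the length of the interval, and force a cut at the start of each large block. *)
Definition cut_weight (j : nat) : R :=
  let b := block_index j in
  if t < sig b then
    beta j / (sig b * t) + sig b / (t * (block_size b)%:R) + (j == block_start b)%:R
  else 0.

Lemma block_size_gt0 b : 0 < (block_size b)%:R :> R.
Proof. by rewrite ltr0n subn_gt0 block_start_lt. Qed.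

Lemma cut_weight_ge0 j : 0 <= cut_weight j.
Proof.
rewrite /cut_weight; case: ifP => // _.
have s0 := sigma_ge0 (block_index j).
rewrite !addr_ge0 // divr_ge0 ?weighted_cmod_ge0 // mulr_ge0 // ltW //.
Qed.

Lemma cut_weight_start b : t < sig b -> 1 <= cut_weight (block_start b).
Proof.
move=> tb; rewrite /cut_weight (@block_index_eq b) ?leqnn ?block_start_lt // tb eqxx.
have t_ge0 := ltW t0; have s0 := sigma_ge0 b; have := weighted_cmod_ge0 (block_start b).
by move=> w0; rewrite lerDr addr_ge0 // divr_ge0 // mulr_ge0.
Qed.

Lemma sum_cut_weight_block b :
  \sum_(block_start b <= j < 2 ^ b) cut_weight j =
  if t < sig b then sig b / t + sig b / t + 1 else 0.
Proof.
transitivity (\sum_(block_start b <= j < 2 ^ b)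
   if t < sig b then
    beta j / (sig b * t) + sig b / (t * (block_size b)%:R) + (j == block_start b)%:R
   else 0).
  by apply: eq_big_nat => j jb; rewrite /cut_weight (block_index_eq jb).
case: ifP => tb; last by rewrite big1.
have s0 : sig b != 0 by rewrite gt_eqF // (lt_trans t0).
have tn0 : t != 0 by rewrite gt_eqF.
rewrite !big_split /=; congr (_ + _ + _).
- by rewrite -mulr_suml -sigma_sqr; field; apply/andP.
- rewrite sumr_const_nat -/(block_size b) -[LHS]mulr_natr.
  have := block_size_gt0 b; move: (block_size b)%:R => s s_gt0.
  by field; rewrite tn0 gt_eqF.
- rewrite (big_ltn (block_start_lt b)) eqxx big_nat_cond big1 ?addr0 // => j.
  by rewrite andbT => /andP[lt _]; rewrite gtn_eqF.
Qed.

(** A large block has total weight [2 * (sig b / t) + 1], and [1 <= sig b / t] there; this is the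
    source of the factor 3. *)
Lemma psum_cut_weight_le n :
  (forall B, 3 * (\sum_(0 <= b < B | t < sig b) sig b) <= n%:R * t) ->
  forall m, psum cut_weight m <= n%:R.
Proof.
move=> H m.
apply: (@le_trans _ _ (psum cut_weight (2 ^ m))).
  by apply: psum_mono; [exact: cut_weight_ge0|rewrite ltnW // ltn_expl].
rewrite /psum sum_dyadic -(ler_pM2r t0); apply: le_trans (H m.+1).
rewrite mulr_suml mulr_sumr [leRHS]big_mkcond /=; apply: ler_sum => b _.
rewrite sum_cut_weight_block; case: ifP => tb; last by rewrite mul0r.
rewrite !mulrDl divfK ?gt_eqF //; lra.
Qed.

(** The number of the interval containing [i]. The weight of [i] is included, so the jump at the
    start of a large block already acts at that start, and labels in large blocks are at least 1. *)
Definition label i : nat := Num.truncn (psum cut_weight i.+1).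

Lemma psum_cut_weight_ge0 m : 0 <= psum cut_weight m.
Proof. by apply: sumr_ge0 => j _; exact: cut_weight_ge0. Qed.

(* Columns j <= i past the first index of the interval of i: since the partial sum at j
   excludes the weight of j, the first index itself is left out. *)
Definition near_row i j := (j <= i)%N && ((label i)%:R <= psum cut_weight j).

(** If [j] lay before the block of [i], the partial sum at [j] would be at least [label i], and the
    jump by 1 at the start of the block would bring the one at [i.+1] to [label i + 1], above its
    own integer part. *)
Lemma near_row_block i j : t < sig (block_index i) -> near_row i j ->
  block_index j = block_index i.
Proof.
move=> ti /andP[ji lj]; apply: block_index_eq.
have /andP[bi i2] := block_indexP i.
rewrite (leq_ltn_trans ji i2) andbT leqNgt; apply/negP => jb.
have := truncnS_gt (psum cut_weight i.+1); rewrite -/(label i) -natr1 ltNge => /negP; apply.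
apply: (@le_trans _ _ (psum cut_weight (block_start (block_index i)).+1)).
  rewrite psumS lerD ?cut_weight_start //.
  by apply: (le_trans lj); apply: psum_mono; [exact: cut_weight_ge0|exact: ltnW].
by apply: psum_mono; [exact: cut_weight_ge0|].
Qed.

(** Schur test with constant column weights, where [t ^+ 2 * cut_weight i] majorizes the row sums:
    both conditions then reduce to the weight of a piece of an interval being at most 1. *)
Lemma near_row_estimate n (x : nat -> R) :
  \sum_(0 <= i < n) (if t < sig (block_index i) then cmod (alpha i) ^+ 2 else 0) *
     (\sum_(0 <= j < n | near_row i j) x j) ^+ 2 <=
  t ^+ 2 * \sum_(0 <= j < n) x j ^+ 2.
Proof.
have cw0 := cut_weight_ge0.
apply: (@schur_test _ n near_row _ (fun i => t ^+ 2 * cut_weight i) (fun=> 1)) => //.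
- by move=> i; case: ifP => // _; exact: sqr_ge0.
- move=> i; case: ifP => ti; last by rewrite mul0r mulr_ge0 ?sqr_ge0.
  set b := block_index i; set N := \sum_(_ <= _ < _ | _) _.
  have s0 : 0 < sig b by apply: lt_trans ti.
  have bs0 := block_size_gt0 b.
  (* [N] counts the near columns. They lie in block [b], each carries at least the length term of
     the weight, and together they weigh at most 1. *)
  have : N * (sig b / (t * (block_size b)%:R)) <= 1.
    rewrite /N mulr_suml.
    apply: (@le_trans _ _ (\sum_(0 <= j < n | near_row i j) cut_weight j)).
      apply: ler_sum => j nij; rewrite invr1 mul1r /cut_weight (near_row_block ti nij).
      rewrite -/b ti -addrA addrCA lerDl addr_ge0 //.
      by rewrite divr_ge0 ?weighted_cmod_ge0 // mulr_ge0 // ltW.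
    apply: (@le_trans _ _ (\sum_(0 <= j < i.+1 | (label i)%:R <= psum cut_weight j) cut_weight j)).
      by apply: ler_sum_nat_widen => // j _ /andP[? ->]; rewrite ltnS andbT.
    apply: (le_trans (sum_psum_ge _ _ cw0)).
    rewrite ge_max ler01 /= lerBlDr addrC natr1.
    by apply/ltW; exact: truncnS_gt.
  rewrite mulrA ler_pdivrMr ?mulr_gt0 // mul1r => NB.
  rewrite /cut_weight -/b ti !mulrDr -addrA.
  apply: (@le_trans _ _ (t ^+ 2 * (beta i / (sig b * t)))); last first.
    rewrite lerDl addr_ge0 // mulr_ge0 ?sqr_ge0 //.
    by rewrite divr_ge0 // ?mulr_ge0 // ltW.
  have -> : t ^+ 2 * (beta i / (sig b * t)) = (t * beta i) / sig b.
    by field; rewrite !gt_eqF.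
  rewrite ler_pdivlMr // -mulrA mulrC.
  apply: (@le_trans _ _ ((t * (block_size b)%:R) * cmod (alpha i) ^+ 2)).
    by rewrite ler_wpM2r ?sqr_ge0.
  (* The length of the block is traded for the factor [i.+1] in the mass term of the weight. *)
  rewrite -mulrA ler_pM2l // ler_wpM2r ?sqr_ge0 // ler_nat.
  exact: block_size_le.
- move=> j; rewrite mul1r -mulr_sumr ler_piMr ?sqr_ge0 //.
  (* If column [j] is near row [i], the label of [i] is at most the integer part of the partial sum
     at [j], so the partial sum at [i.+1] stays below [d], which exceeds the one at [j] by at most
     1. *)
  set d : R := (Num.truncn (psum cut_weight j)).+1%:R.
  apply: (@le_trans _ _ (\sum_(0 <= i < n | (j <= i)%N && (psum cut_weight i.+1 <= d)) cut_weight i)).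
    apply: ler_sum_nat_widen => // i -> /andP[-> lab] /=.
    rewrite ltW // (lt_le_trans (truncnS_gt _)) // ler_nat ltnS -/(label i).
    by rewrite truncn_ge_nat // psum_cut_weight_ge0.
  apply: (le_trans (sum_psum_le _ _ _ cw0)).
  rewrite ge_max ler01 /= lerBlDr /d -natr1 addrC lerD2l truncn_le.
  exact: psum_cut_weight_ge0.
Qed.

(** * The dyadic Hardy inequality for the rows of small blocks *)

Lemma sum_inv_block_weight B :
  \sum_(0 <= j < 2 ^ B) ((3 / 2) ^+ block_index j)^-1 <= 2 * (4 / 3) ^+ B :> R.
Proof.
elim: B => [|B IH].
  by rewrite big_nat1 /block_index up_log1 !expr0 invr1 mulr1; lra.
rewrite (big_cat_nat _ (n := (2 ^ B)%N)) //=; last by rewrite leq_exp2l.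
have -> : \sum_(2 ^ B <= j < 2 ^ B.+1) ((3 / 2) ^+ block_index j)^-1
          = 2 / 3 * (4 / 3) ^+ B :> R.
  rewrite (eq_big_nat _ _ (F2 := fun=> (2 / 3) ^+ B.+1)); last first.
    move=> j jB; rewrite (@block_index_eq B.+1) ?block_startS // -exprVn.
    by congr (_ ^+ _); field.
  rewrite sumr_const_nat expnS mul2n -addnn addnK -[LHS]mulr_natr natrX exprS -mulrA -exprMn.
  by congr (_ * _ ^+ _); field.
(* The induction closes because [2 + 2 / 3 = 2 * (4 / 3)]. *)
by rewrite exprS; lra.
Qed.

(** Schur test with column weights [r ^+ b] on block [b], [r = 3 / 2]. Since [r < 2], the row sums
    are dominated by the last block and grow like [(2 / r) ^+ b]; since [1 < r], the columns are
    left with a convergent geometric tail. *)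
Lemma small_row_estimate n (x : nat -> R) :
  \sum_(0 <= i < n) (if t < sig (block_index i) then 0 else cmod (alpha i) ^+ 2) *
     (\sum_(0 <= j < n | (j <= i)%N) x j) ^+ 2 <=
  12 * t ^+ 2 * \sum_(0 <= j < n) x j ^+ 2.
Proof.
set a := fun i => if t < sig (block_index i) then 0 else cmod (alpha i) ^+ 2.
have a0 i : 0 <= a i by rewrite /a; case: ifP => // _; exact: sqr_ge0.
have h0 j : 0 < (3 / 2 : R) ^+ block_index j by rewrite exprn_gt0 //; lra.
have p0 m : 0 <= (2 / 3 : R) ^+ m by rewrite exprn_ge0 //; lra.
have q0 m : 0 <= (4 / 3 : R) ^+ m by rewrite exprn_ge0 //; lra.
apply: (@schur_test _ n (fun i j => (j <= i)%N) a
  (fun i => a i * (2 * (4 / 3) ^+ block_index i))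
  (fun j => (3 / 2) ^+ block_index j)) => //.
  move=> i; rewrite ler_wpM2l //; apply: le_trans (sum_inv_block_weight _).
  apply: ler_sum_nat_widen => j; first by rewrite invr_ge0 ltW.
  move=> _ ji; rewrite andbT; apply: leq_ltn_trans ji _.
  by have /andP[] := block_indexP i.
move=> j; set B := block_index j.
have u0 i : 0 <= a i * (2 * (4 / 3) ^+ block_index i) by rewrite !mulr_ge0.
(* As [(4 / 3) ^+ b = 2 ^+ b * (2 / 3) ^+ b] and [2 ^ b <= 2 * i.+1] on block [b], the factor
   [2 ^+ b] is absorbed by the weight [i.+1] in [sig b ^+ 2], which is at most [t ^+ 2] on a small
   block. *)
have blk b : \sum_(block_start b <= i < 2 ^ b) a i * (2 * (4 / 3) ^+ block_index i)
    <= 4 * t ^+ 2 * (2 / 3) ^+ b.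
  apply: (@le_trans _ _ (\sum_(block_start b <= i < 2 ^ b)
      (if t < sig b then 0 else beta i) * (4 * (2 / 3) ^+ b))).
    rewrite big_nat [leRHS]big_nat; apply: ler_sum => i ib.
    rewrite /a (block_index_eq ib); case: ifP => _; first by rewrite !mul0r.
    have -> : (4 / 3 : R) ^+ b = 2 ^+ b * (2 / 3) ^+ b.
      by rewrite -exprMn; congr (_ ^+ _); field.
    rewrite [leLHS](_ : _ = 2 * cmod (alpha i) ^+ 2 * (2 / 3) ^+ b * 2 ^+ b); last by ring.
    rewrite [leRHS](_ : _ = 2 * cmod (alpha i) ^+ 2 * (2 / 3) ^+ b * (2 * i.+1%:R)); last by ring.
    apply: ler_wpM2l; first by rewrite mulr_ge0 // mulr_ge0 ?sqr_ge0.
    have : (2 ^ b <= 2 * i.+1)%N by case: b ib => [|b]; rewrite ?block_startS ?expnS; lia.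
    by rewrite -(ler_nat R) natrX natrM.
  rewrite -mulr_suml; case tb: (t < sig b).
    by rewrite big1 // mul0r mulr_ge0 ?p0 // mulr_ge0 ?sqr_ge0.
  rewrite -sigma_sqr mulrA ler_wpM2r ?p0 // mulrC ler_wpM2l //.
  by rewrite ler_pXn2r ?nnegrE ?sigma_ge0 ?(ltW t0) // leNgt tb.
have tail : \sum_(0 <= i < n | (j <= i)%N) a i * (2 * (4 / 3) ^+ block_index i)
    <= 4 * t ^+ 2 * (3 * (2 / 3) ^+ B).
  (* The range is enlarged to whole blocks, using [n < 2 ^ n] and the monotonicity of
     [block_index]. *)
  apply: (@le_trans _ _ (\sum_(0 <= i < 2 ^ n)
      if (B <= block_index i)%N then a i * (2 * (4 / 3) ^+ block_index i) else 0)).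
    rewrite -big_mkcond; apply: ler_sum_nat_widen => // i lt_in ji.
    by rewrite block_index_mono // andbT (ltn_trans lt_in) // ltn_expl.
  rewrite sum_dyadic.
  apply: (@le_trans _ _ (\sum_(0 <= b < n.+1 | (B <= b)%N) 4 * t ^+ 2 * (2 / 3) ^+ b)).
    rewrite [leRHS]big_mkcond; apply: ler_sum => b _.
    rewrite (eq_big_nat _ _ (F2 := fun i => if (B <= b)%N then
        a i * (2 * (4 / 3) ^+ block_index i) else 0)); last first.
      by move=> i /block_index_eq ->.
    by case: ifP => _; [exact: blk|rewrite big1].
  rewrite -mulr_sumr; apply: ler_wpM2l; first by rewrite mulr_ge0 ?sqr_ge0.
  apply: (@le_trans _ _ ((2 / 3) ^+ B / (1 - 2 / 3))).
    by apply: geometric_tail_le; apply/andP; split; lra.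
  by rewrite (_ : 1 - 2 / 3 = 3^-1) ?invrK ?[_ * 3]mulrC //; field.
have -> : 12 * t ^+ 2 = (3 / 2) ^+ B * (4 * t ^+ 2 * (3 * (2 / 3) ^+ B)).
  have -> : (3 / 2) ^+ B * (4 * t ^+ 2 * (3 * (2 / 3) ^+ B))
      = 12 * t ^+ 2 * ((3 / 2) ^+ B * (2 / 3) ^+ B) by ring.
  by rewrite -exprMn (_ : 3 / 2 * (2 / 3) = 1) ?expr1n ?mulr1 //; field.
by rewrite ler_wpM2l // ltW.
Qed.

End Estimates.

(** * The finite-rank approximant and the norm of the remainder *)

Section Approximation.
Variable R : realType.

Lemma nneseries_le_of_psum (u : nat -> \bar R) (x : \bar R) :
  (forall k, (0 <= u k)%E) -> (forall n, (\sum_(0 <= k < n) u k <= x)%E) ->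
  (\sum_(0 <= k <oo) u k <= x)%E.
Proof.
move=> u0 H; apply: lime_le; first exact: is_cvg_nneseries.
by apply: nearW => n; exact: H.
Qed.

Lemma cmod_sum (s : seq nat) (Q : pred nat) (f : nat -> R[i]) :
  cmod (\sum_(j <- s | Q j) f j) <= \sum_(j <- s | Q j) cmod (f j).
Proof.
elim/big_ind2 : _ => [|x x' y y' Hx Hy|//]; first by rewrite /cmod ComplexField.Normc.normc0.
by apply: (le_trans (le_normcD _ _)); rewrite lerD.
Qed.

Lemma cmodM (x y : R[i]) : cmod (x * y) = cmod x * cmod y.
Proof. exact: ComplexField.Normc.normcM. Qed.

Lemma l2norm2_le1 (f : nat -> R[i]) : (l2norm f <= 1)%E -> (l2norm2 f <= 1)%E.
Proof.
rewrite /l2norm; set x := l2norm2 f => H.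
have x0 : (0 <= x)%E by apply: nneseries_ge0 => k _ _; rewrite lee_fin sqr_ge0.
have -> : x = ((x `^ 2^-1) `^ 2)%E by rewrite -poweRrM mulVf ?poweRe1 // pnatr_eq0.
rewrite -[leRHS](poweR1r 2).
by apply: gt0_ler_poweR => //; rewrite in_itv /= leey andbT ?poweR_ge0 ?lee01.
Qed.

Lemma l2norm_le (f : nat -> R[i]) (c : R) : 0 <= c ->
  (forall n, \sum_(0 <= k < n) cmod (f k) ^+ 2 <= c ^+ 2) -> (l2norm f <= c%:E)%E.
Proof.
move=> c0 H; rewrite /l2norm.
have -> : c%:E = ((c ^+ 2)%:E `^ 2^-1)%E.
  by rewrite poweR_EFin -powR_mulrn // -powRrM mulfV ?powRr1 // pnatr_eq0.
apply: gt0_ler_poweR; rewrite ?in_itv /= ?leey ?andbT ?lee_fin ?sqr_ge0 ?invr_ge0 //.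
  by apply: nneseries_ge0 => k _ _; rewrite lee_fin sqr_ge0.
apply: nneseries_le_of_psum => [k|n]; first by rewrite lee_fin sqr_ge0.
by rewrite sumEFin lee_fin.
Qed.

Variables (alpha : nat -> R[i]) (t : R).
Hypothesis t0 : 0 < t.

Local Notation sig := (sigma_seq alpha).
Local Notation lab := (label alpha t).
Local Notation W := (psum (cut_weight alpha t)).

(** On a large row this keeps exactly the columns that are not near: those up to the first index of
    the interval of [i], inclusive. *)
Definition head_op (f : nat -> R[i]) (i : nat) : R[i] :=
  if t < sig (block_index i) then
    alpha i * \sum_(0 <= j < i.+1 | W j < (lab i)%:R) f j
  else 0.

(** Columns beyond [i] have partial sum at least the common label, so a later row of the same
    interval gains no term. *)
Lemma head_op_coef (f : nat -> R[i]) i i' : lab i = lab i' ->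
  \sum_(0 <= j < i.+1 | W j < (lab i)%:R) f j =
  \sum_(0 <= j < i'.+1 | W j < (lab i')%:R) f j.
Proof.
wlog ii' : i i' / (i <= i')%N => [hw|e].
  by case: (leqP i i') => [|/ltnW] ? e; [exact: hw|apply/esym/hw].
rewrite e [RHS](big_cat_nat _ (n := i.+1)) //= [X in _ = _ + X]big_nat_cond.
rewrite [X in _ = _ + X]big1 ?addr0 // => j /andP[/andP[ij _]]; rewrite ltNge => /negP[].
apply: (@le_trans _ _ (W i.+1)); last by apply: psum_mono => // k; exact: cut_weight_ge0.
by rewrite -e truncn_le psum_cut_weight_ge0.
Qed.

Lemma head_op_rank n : inl2 alpha -> (forall m, W m <= n%:R) ->
  lin_rank_le n head_op.
Proof.
move=> al2 Wn; split.
  move=> a f g _ _; apply/funext => i; rewrite /head_op; case: ifP => _; last by rewrite mulr0 addr0.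
  by rewrite big_split /= -mulr_sumr; ring.
(* One generator per interval, namely [alpha] restricted to its large rows; labels of large rows run
   from 1 to [n], whence the shift [c.+1]. *)
exists (fun (c : 'I_n) i => if (t < sig (block_index i)) && (lab i == c.+1) then alpha i else 0).
split.
  move=> c; apply: le_lt_trans al2; apply: lee_nneseries => [k _ _|k _]; rewrite lee_fin ?sqr_ge0 //.
  case: ifP => // _; rewrite /cmod ComplexField.Normc.normc0 expr0n /=; exact: sqr_ge0.
move=> f _.
(* A representative row of each interval. The default 0 is taken only when no row has label [c.+1],
   and then the generator vanishes. *)
pose row (c : 'I_n) := xget 0%N [set i | lab i = c.+1].
exists (fun c => \sum_(0 <= j < (row c).+1 | W j < (lab (row c))%:R) f j).
apply/funext => i; rewrite /head_op; case: ifP => ti; last first.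
  by rewrite big1 // => c _; rewrite mulr0.
have lab_gt0 : (0 < lab i)%N.
  rewrite truncn_gt0.
  have /andP[bi _] := block_indexP i.
  apply: (@le_trans _ _ (W (block_start (block_index i)).+1)).
    by rewrite psumS ler_wpDl ?psum_cut_weight_ge0 ?cut_weight_start.
  by apply: psum_mono => // k; exact: cut_weight_ge0.
have lab_le : (lab i <= n)%N.
  rewrite -(ler_nat R); apply: le_trans (Wn i.+1).
  by rewrite truncn_le psum_cut_weight_ge0.
have lt : ((lab i).-1 < n)%N by rewrite prednK.
rewrite (bigD1 (Ordinal lt)) //= prednK // eqxx [X in _ = _ + X]big1 ?addr0; last first.
  move=> c /negP nc; case: ifP => [/eqP e|]; last by rewrite mulr0.
  by case: nc; apply/eqP/val_inj => /=; rewrite e.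
rewrite mulrC; congr (_ * _); apply: head_op_coef; apply/esym.
rewrite /row /= prednK //.
by apply: (@xgetPex _ 0%N [set k | lab k = lab i]); exists i.
Qed.

(** Each row is either large, leaving the near columns, or small, leaving all columns up to [i]; so
    the squared bounds simply add up, [13 = 1 + 12]. *)
Lemma remainder_estimate (f : nat -> R[i]) n :
  \sum_(0 <= i < n) cmod (Ralpha alpha f i - head_op f i) ^+ 2 <=
  13 * t ^+ 2 * \sum_(0 <= j < n) cmod (f j) ^+ 2.
Proof.
set x := fun j => cmod (f j).
have x0 j : 0 <= x j by exact: cmod_ge0.
have -> : 13 * t ^+ 2 * \sum_(0 <= j < n) x j ^+ 2 =
    t ^+ 2 * (\sum_(0 <= j < n) x j ^+ 2) + 12 * t ^+ 2 * (\sum_(0 <= j < n) x j ^+ 2) by ring.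
apply: le_trans (lerD (near_row_estimate alpha t0 n x) (small_row_estimate alpha t0 n x)).
rewrite -big_split /= big_nat [leRHS]big_nat; apply: ler_sum => i /andP[_ lt_in].
have key (Q Q' : pred nat) : (forall j, (j < i.+1)%N -> Q j -> Q' j) ->
    cmod (alpha i * \sum_(0 <= j < i.+1 | Q j) f j) ^+ 2 <=
    cmod (alpha i) ^+ 2 * (\sum_(0 <= j < n | Q' j) x j) ^+ 2.
  move=> QQ'; rewrite cmodM exprMn ler_wpM2l ?sqr_ge0 //.
  rewrite ler_pXn2r ?nnegrE ?cmod_ge0 ?sumr_ge0 //.
  apply: (le_trans (cmod_sum _ _ _)); apply: ler_sum_nat_widen => // j ji Qj.
  by rewrite QQ' // andbT (leq_trans ji).
rewrite /head_op /Ralpha -(big_mkord xpredT f); case: ifP => ti.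
  rewrite mul0r addr0 -mulrBr.
  rewrite (bigID (fun j => W j < (lab i)%:R)) /= addrAC subrr add0r.
  by apply: key => j ji; rewrite -leNgt /near_row -ltnS ji.
by rewrite mul0r add0r subr0; apply: key.
Qed.

(** The hypothesis bounds the total cut weight, hence the rank of [head_op], by [n]; the constant 4
    comes from [13 <= 4 ^ 2]. *)
Lemma approx_num_le n : inl2 alpha ->
  (forall B, 3 * (\sum_(0 <= b < B | t < sig b) sig b) <= n%:R * t) ->
  (approx_num (Ralpha alpha) n <= (4 * t)%:E)%E.
Proof.
move=> al2 H; apply: (@le_trans _ _ (opnorm (fun f k => Ralpha alpha f k - head_op f k))).
  apply: ereal_inf_lbound; exists head_op => //.
  by apply: head_op_rank => //; exact: psum_cut_weight_le.
apply: ge_ereal_sup => _ [f [_ f1] <-]; apply: l2norm_le => [|n'].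
  by rewrite mulr_ge0 // ltW.
apply: (le_trans (remainder_estimate f n')).
have : \sum_(0 <= j < n') cmod (f j) ^+ 2 <= 1.
  rewrite -lee_fin -sumEFin; apply: le_trans (l2norm2_le1 f1).
  by apply: nneseries_lim_ge => k _ _; rewrite lee_fin sqr_ge0.
by have := exprn_gt0 2 t0; nra.
Qed.

End Approximation.

(** * Geometric sums, counting and real powers *)

Section LayerCake.
Variable R : realType.

(** The terms below [S] form a geometric progression whose first term is below [S]. The induction
    varies [x]: while [S <= x], the first term drops out and [x] becomes [x * q]. *)
Lemma geometric_below (q S : R) N : 0 <= q < 1 -> 0 <= S -> forall x, 0 <= x ->
  \sum_(0 <= m < N) (if x * q ^+ m < S then x * q ^+ m else 0) <= S / (1 - q).
Proof.
move=> q01 S0; have /andP[q0 q1] := q01.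
have d0 : 0 < 1 - q by rewrite subr_gt0.
elim: N => [|N IH] x x0; first by rewrite big_nil divr_ge0 // ltW.
case: (ltP x S) => xS.
  apply: (@le_trans _ _ (\sum_(0 <= m < N.+1) x * q ^+ m)).
    by apply: ler_sum => m _; case: ifP => // _; rewrite mulr_ge0 ?exprn_ge0.
  rewrite -mulr_sumr; apply: (@le_trans _ _ (x * (1 - q)^-1)).
    apply: ler_wpM2l => //; apply: le_trans (geometric_tail_le 0 N.+1 q01) _.
    by rewrite expr0 mul1r.
  by rewrite ler_wpM2r ?invr_ge0 // ltW.
rewrite big_nat_recl // expr0 mulr1 ltNge xS add0r.
apply: le_trans (IH (x * q) (mulr_ge0 x0 q0)).
by apply: ler_sum => m _; rewrite exprS mulrA.
Qed.

Lemma count_nat_lt (z : R) N : 0 <= z ->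
  \sum_(0 <= n < N) (n%:R < z)%R%:R <= z + 1 :> R.
Proof.
move=> z0.
(* The bound by [N] is carried along because, when [N] itself is counted, [N < z] turns it into the
   bound by [z + 1]. *)
suff : \sum_(0 <= n < N) (n%:R < z)%R%:R <= N%:R :> R /\
       \sum_(0 <= n < N) (n%:R < z)%R%:R <= z + 1 :> R by case.
elim: N => [|N [IH1 IH2]]; first by rewrite big_nil; split => //; lra.
rewrite big_nat_recr //= -natr1; move: (\sum_(_ <= _ < _) _) IH1 IH2 => S.
by case: (ltP N%:R z) => zN /= ? ?; split; lra.
Qed.

Lemma half_powR_lt1 (r : R) : 0 < r -> 2^-1 `^ r < 1.
Proof.
move=> r0; have := @gt0_ltr_powR R r r0 2^-1 1; rewrite powR1; apply.
- by rewrite nnegrE invr_ge0.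
- by rewrite nnegrE.
- by rewrite invf_lt1 // ltr1n.
Qed.

Lemma powR_exprn (x r : R) m : 0 <= x -> (x ^+ m) `^ r = (x `^ r) ^+ m.
Proof.
move=> x0; elim: m => [|m IH]; first by rewrite !expr0 powR1.
by rewrite !exprS powRM ?exprn_ge0 // IH.
Qed.

Lemma powR_pred (r x : R) : 0 < r -> 0 <= x -> x `^ r = x * x `^ (r - 1).
Proof.
move=> r0 x0; have [->|xn0] := eqVneq x 0; first by rewrite mul0r powR0 // gt_eqF.
have -> : x `^ r = x `^ (1 + (r - 1)) by congr (_ `^ _); ring.
by rewrite (@powRD _ x 1 (r - 1)) ?powRr1 //; apply/implyP.
Qed.

Lemma nneseries_ge_term (u : nat -> \bar R) m : (forall k, (0 <= u k)%E) ->
  (u m <= \sum_(0 <= k <oo) u k)%E.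
Proof.
move=> u0; apply: le_trans (nneseries_lim_ge m.+1 _) => //.
by rewrite big_nat_recr //= leeDr // sume_ge0.
Qed.

(** * Summation over the levels, for abstract sequences related by [a_le] *)

Variables (sig : nat -> R) (a : nat -> \bar R).
Hypothesis sig0 : forall b, 0 <= sig b.
Hypothesis a0 : forall n, (0 <= a n)%E.
Hypothesis a_le : forall (t : R) n, 0 < t ->
  (forall B, 3 * (\sum_(0 <= b < B | t < sig b) sig b) <= n%:R * t) ->
  (a n <= (4 * t)%:E)%E.

(** By [a_le], [4 * t < a n] forces [n < 3 * Y / t], which leaves at most [3 * Y / t + 1] indices.
    If some [sig b] exceeds [t], then [t <= Y] absorbs the extra 1; otherwise [a_le] excludes every
    [n]. *)
Lemma count_level (t : R) : 0 < t ->
  (\sum_(0 <= n <oo) (((4 * t)%:E < a n)%E%:R : R)%:E <=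
   (6 / t)%:E * \sum_(0 <= b <oo) (if t < sig b then sig b else 0)%:E)%E.
Proof.
move=> t0; set Y := (X in (_ * X)%E).
have v0 b : (0 <= (if t < sig b then sig b else 0)%:E)%E by rewrite lee_fin; case: ifP.
have Y0 : (0 <= Y)%E by apply: nneseries_ge0.
have c0 : 0 < 6 / t by rewrite divr_gt0.
have [[b tb]|none] := pselect (exists b, t < sig b); last first.
  apply: (@le_trans _ _ 0%E); last by rewrite mule_ge0 // lee_fin ltW.
  apply: nneseries_le_of_psum => [k|n]; first by rewrite lee_fin.
  rewrite big1 // => k _; rewrite ltNge a_le // => B.
  rewrite big1 ?mulr0 ?mulr_ge0 // ?ltW // => b tb; exfalso; apply: none; by exists b.
have tY : (t%:E <= Y)%E.
  apply: le_trans (nneseries_ge_term b v0); by rewrite tb lee_fin ltW.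
have partial B : ((\sum_(0 <= b < B | t < sig b) sig b)%:E <= Y)%E.
  by rewrite big_mkcond -sumEFin; apply: nneseries_lim_ge.
case: Y Y0 tY partial => [y||] //=; last by rewrite gt0_muley ?leey ?lte_fin.
rewrite !lee_fin => y0 ty partial.
apply: nneseries_le_of_psum => [k|n]; first by rewrite lee_fin.
rewrite sumEFin -EFinM lee_fin.
have z0 : 0 <= 3 * y / t by rewrite divr_ge0 ?mulr_ge0 // ltW.
apply: (@le_trans _ _ (\sum_(0 <= k < n) (k%:R < 3 * y / t)%R%:R)).
  apply: ler_sum => k _; rewrite ler_nat.
  case: (ltP k%:R _) => [_|]; first by case: (_ < _)%E.
  rewrite ler_pdivrMr // => ky; rewrite ltNge a_le // => B.
  by apply: le_trans ky; rewrite ler_pM2l // -lee_fin.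
apply: (le_trans (count_nat_lt n z0)).
have : 1 <= y / t by rewrite ler_pdivlMr // mul1r.
rewrite (_ : 6 / t * y = 6 * (y / t)) -?[3 * y / t]mulrA; last by ring.
by lra.
Qed.

(** A single term suffices: for the first [m] with [4 * (M / 2 ^+ m.+1) < a n], the failure of the
    preceding level gives [a n <= 8 * (M / 2 ^+ m.+1)]. *)
Lemma layer_bound (p M : R) : 0 < p -> 0 < M -> (forall b, sig b <= M) -> forall n,
  (a n `^ p <= \sum_(0 <= m <oo)
     ((8 * (M / 2 ^+ m.+1)) `^ p * ((4 * (M / 2 ^+ m.+1))%:E < a n)%E%:R)%:E)%E.
Proof.
move=> p0 M0 sM n; pose u m :=
  ((8 * (M / 2 ^+ m.+1)) `^ p * ((4 * (M / 2 ^+ m.+1))%:E < a n)%E%:R)%:E.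
have u0 m : (0 <= u m)%E by rewrite lee_fin mulr_ge0 ?powR_ge0.
(* No [sig b] exceeds [M], so the level [M] is admissible for every [n], even 0; this covers the
   case where the first [m] is 0. *)
have aM : (a n <= (4 * M)%:E)%E.
  apply: a_le => // B; rewrite big1 ?mulr0 ?mulr_ge0 ?(ltW M0) // => b.
  by rewrite ltNge sM.
have := a0 n; rewrite le_eqVlt => /orP[/eqP <-|an0].
  rewrite poweR0r ?gt_eqF //; apply: nneseries_ge0 => m _ _.
  by rewrite lee_fin mulr_ge0 ?powR_ge0.
have [r an] : exists r, a n = r%:E.
  by case: (a n) an0 aM => [r||] //; exists r.
rewrite an lte_fin lee_fin in an0 aM.
have ex : exists m, 4 * (M / 2 ^+ m.+1) < r.
  exists (Num.truncn (4 * M / r)).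
  rewrite mulrA ltr_pdivrMr ?exprn_gt0 // [ltRHS]mulrC -ltr_pdivrMr //.
  apply: (lt_trans (truncnS_gt _)).
  by have := ltn_expl (Num.truncn (4 * M / r)).+1 (ltnSn 1); rewrite -(ltr_nat R) natrX.
case: (ex_minnP ex) => m mr min.
apply: le_trans (nneseries_ge_term m u0).
rewrite /u an lte_fin mr mulr1 poweR_EFin lee_fin.
apply: ge0_ler_powR; rewrite ?nnegrE ?(ltW p0) ?(ltW an0) //.
  by rewrite mulr_ge0 // divr_ge0 ?exprn_ge0 // ltW.
rewrite (_ : 8 * (M / 2 ^+ m.+1) = 4 * (M / 2 ^+ m)); last first.
  by rewrite exprS; field; rewrite expf_neq0.
case: m mr min => [|m] mr min; first by rewrite expr0 divr1.
by rewrite leNgt; apply/negP => /min; rewrite ltnn.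
Qed.

Lemma level_sum (p M s : R) N : 1 < p -> 0 < M -> 0 <= s ->
  \sum_(0 <= m < N) (if M / 2 ^+ m.+1 < s then (M / 2 ^+ m.+1) `^ (p - 1) else 0)
    <= s `^ (p - 1) / (1 - 2^-1 `^ (p - 1)).
Proof.
move=> p1 M0 s0; have p10 : 0 < p - 1 by rewrite subr_gt0.
set q := 2^-1 `^ (p - 1).
have q01 : 0 <= q < 1.
  by rewrite powR_ge0 half_powR_lt1.
set x := (M / 2) `^ (p - 1).
have tE m : (M / 2 ^+ m.+1) `^ (p - 1) = x * q ^+ m.
  rewrite exprS invfM mulrA powRM ?divr_ge0 ?invr_ge0 ?exprn_ge0 ?(ltW M0) //.
  by rewrite -exprVn powR_exprn ?invr_ge0.
apply: le_trans (geometric_below N q01 (powR_ge0 s (p - 1)) (powR_ge0 (M / 2) (p - 1))).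
apply: ler_sum => m _; rewrite -/x -tE; case: ifP => ts.
  rewrite gt0_ltr_powR ?nnegrE //.
  by rewrite divr_ge0 ?exprn_ge0 // ltW.
by case: ifP => // _; exact: powR_ge0.
Qed.

(** Two exchanges of nonnegative sums: first the level is fixed and the indices [n] are counted,
    then [b] is fixed and the levels below [sig b] are summed. *)
Lemma sum_power_le (p M : R) : 1 < p -> 0 < M -> (forall b, sig b <= M) ->
  (\sum_(0 <= n <oo) a n `^ p <=
   (6 * 8 `^ p / (1 - 2^-1 `^ (p - 1)))%:E * \sum_(0 <= b <oo) (sig b `^ p)%:E)%E.
Proof.
move=> p1 M0 sM; have p0 : 0 < p by rewrite (lt_trans _ p1).
pose t m := M / 2 ^+ m.+1.
have t0 m : 0 < t m by rewrite divr_gt0 ?exprn_gt0.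
pose c m := (8 * t m) `^ p.
have c0 m : 0 <= c m by exact: powR_ge0.
have i0 (m n : nat) : (0 <= (((4 * t m)%:E < a n)%E%:R : R)%:E)%E by rewrite lee_fin.
have v0 (m b : nat) : (0 <= (if t m < sig b then sig b else 0)%:E)%E.
  by rewrite lee_fin; case: ifP.
apply: (@le_trans _ _ (\sum_(0 <= n <oo) \sum_(0 <= m <oo)
    ((c m)%:E * (((4 * t m)%:E < a n)%E%:R : R)%:E))%E).
  apply: lee_nneseries => [n _ _|n _]; first exact: poweR_ge0.
  exact: layer_bound.
rewrite nneseries_interchange; last by move=> n m; rewrite mule_ge0 // lee_fin.
apply: (@le_trans _ _ (\sum_(0 <= m <oo) \sum_(0 <= b <oo)
    ((c m * (6 / t m))%:E * (if t m < sig b then sig b else 0)%:E))%E).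
  apply: lee_nneseries => [m _ _|m _].
    by apply: nneseries_ge0 => n _ _; rewrite mule_ge0 // lee_fin.
  rewrite [leRHS]nneseriesZl // [leLHS]nneseriesZl //.
  rewrite (EFinM (c m)) -muleA; apply: lee_wpmul2l; first by rewrite lee_fin.
  exact: count_level.
have w0 (m b : nat) : (0 <= (c m * (6 / t m))%:E * (if t m < sig b then sig b else 0)%:E)%E.
  by rewrite mule_ge0 // lee_fin mulr_ge0 // divr_ge0 // ltW.
rewrite nneseries_interchange // -nneseriesZl; last by move=> b _; rewrite lee_fin powR_ge0.
apply: lee_nneseries => [b _ _|b _]; first by apply: nneseries_ge0 => *; exact: w0.
apply: nneseries_le_of_psum => [m|N]; first exact: w0.
rewrite sumEFin -EFinM lee_fin.
(* The factor [1 / t m] from the counting lowers the exponent of the level from [p] to [p - 1]. *)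
have termE m : c m * (6 / t m) * (if t m < sig b then sig b else 0) =
    6 * 8 `^ p * sig b * (if t m < sig b then t m `^ (p - 1) else 0).
  case: ifP => _; last by rewrite !mulr0.
  rewrite /c powRM ?(ltW (t0 m)) //.
  rewrite (powR_pred p0 (ltW (t0 m))).
  have := t0 m; move: (t m) (t m `^ (p - 1)) => x y x0.
  by field; rewrite gt_eqF.
under eq_bigr do rewrite termE.
rewrite -mulr_sumr.
rewrite (powR_pred p0 (sig0 b)).
apply: (@le_trans _ _ (6 * 8 `^ p * sig b * (sig b `^ (p - 1) / (1 - 2^-1 `^ (p - 1))))).
  apply: ler_wpM2l; last exact: level_sum.
  by rewrite mulr_ge0 // mulr_ge0 // powR_ge0.
by rewrite le_eqVlt; apply/orP; left; apply/eqP; ring.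
Qed.

End LayerCake.

(** * Nonnegativity of approximation numbers and conclusion *)

Lemma approx_num_ge0 (R : realType) (T : (nat -> R[i]) -> (nat -> R[i])) n :
  (0 <= approx_num T n)%E.
Proof.
apply: le_ereal_inf_tmp => _ [P _ <-].
have z2 : l2norm2 (fun=> 0 : R[i]) = 0%E.
  by apply: eseries0 => k _ _; rewrite /cmod ComplexField.Normc.normc0 expr0n.
(* The zero sequence is admissible in the supremum defining [opnorm]. *)
apply: (@le_trans _ _ (l2norm (fun k => T (fun=> 0) k - P (fun=> 0) k))).
  exact: poweR_ge0.
apply: ereal_sup_ubound; exists (fun=> 0) => //.
split; first by rewrite /inl2 z2.
by rewrite /l2norm z2 poweR0r ?invr_eq0 // lee01.
Qed.

Theorem theorem5p7 (R : realType) (p : R) (hp : 1 < p) :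
  exists Cp : R, 0 < Cp /\
    forall alpha : nat -> R[i], inl2 alpha ->
      ((\sum_(0 <= n <oo) (approx_num (Ralpha alpha) n) `^ p) `^ p^-1
        <= Cp%:E * (\sum_(0 <= k <oo) ((sigma_seq alpha k) `^ p)%:E) `^ p^-1)%E.
Proof.
have p0 : 0 < p by rewrite (lt_trans _ hp).
set D := 6 * 8 `^ p / (1 - 2^-1 `^ (p - 1)).
have D0 : 0 < D.
  rewrite divr_gt0 ?mulr_gt0 ?powR_gt0 // subr_gt0.
  by rewrite half_powR_lt1 // subr_gt0.
exists (D `^ p^-1); split => [|alpha al2]; first exact: powR_gt0.
set S := (\sum_(0 <= k <oo) (sigma_seq alpha k `^ p)%:E)%E.
have s0 k : (0 <= (sigma_seq alpha k `^ p)%:E)%E by rewrite lee_fin powR_ge0.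
have S0 : (0 <= S)%E by apply: nneseries_ge0.
have [Soo|Sfin] := eqVneq S +oo%E.
  by rewrite Soo poweRyr ?invr_eq0 ?gt_eqF // gt0_muley ?leey // lte_fin powR_gt0.
have [M SM] : exists M, S = M%:E by case: S S0 Sfin => [M||] //; exists M.
have M0 : 0 <= M by rewrite -lee_fin -SM.
(* One term is at most the whole sum; the added 1 makes the top level positive even when [M = 0]. *)
have sM b : sigma_seq alpha b <= M `^ p^-1 + 1.
  apply: (@le_trans _ _ (M `^ p^-1)); last by rewrite lerDl.
  rewrite -[leLHS](powRr1 (sigma_ge0 alpha b)) -(divff (lt0r_neq0 p0)) powRrM.
  apply: ge0_ler_powR; rewrite ?nnegrE ?powR_ge0 ?invr_ge0 ?(ltW p0) //.
  by rewrite -lee_fin -SM; apply: (nneseries_ge_term b s0).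
have M'0 : 0 < M `^ p^-1 + 1 by rewrite ltr_wpDl ?powR_ge0.
rewrite -poweR_EFin -poweRM ?lee_fin ?(ltW D0) //.
apply: gt0_ler_poweR; rewrite ?invr_ge0 ?(ltW p0) ?in_itv /= ?leey ?andbT //.
- by apply: nneseries_ge0 => n _ _; exact: poweR_ge0.
- by rewrite mule_ge0 // lee_fin ltW.
apply: (sum_power_le (sigma_ge0 alpha) _ _ hp M'0 sM).
- by move=> n; exact: approx_num_ge0.
- by move=> t n t0; exact: approx_num_le.
Qed.
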